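(* Let $a$ and $b$ be positive integers such that $b$ divides $a$, and let $q(x)\in\mathbb{Q}(x)$ be a rational function over $\mathbb{Q}$. Then $f(x,q(x))\in\mathbb{Z}[x]$ if and only if \[q(x)\in\Bigl\{\frac{F_i(x)}{F_{i+1}(x)}\Bigr\}_{i\in\mathbb{N}}\quad\text{or}\quad q(x)\in\Bigl\{-\frac{F_{i+1}(x)}{bF_i(x)}\Bigr\}_{i\in\mathbb{N}^{+}}.\]
   Context: Here $\mathbb{N}=\{0,1,2,\dots\}$ and $\mathbb{N}^{+}=\{1,2,3,\dots\}$. For positive integers $a,b$, the polynomial sequence $\{F_i(x)\}_{i\in\mathbb{N}}$ in $\mathbb{Z}[x]$ is defined by $F_0(x)=0$, $F_1(x)=1$ and $F_{i+2}(x)=ax\,F_{i+1}(x)+b\,F_i(x)$ for $i\in\mathbb{N}$. Its generating function is taken to be the rational expression \[f(x,t)=\frac{t}{1-axt-bt^2},\] so $f(x,q(x))=\dfrac{q(x)}{1-ax\,q(x)-b\,q(x)^2}$ is an element of $\mathbb{Q}(x)$ (no convergence condition is imposed). *)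

(* Defs.v *)
From mathcomp Require Import all_boot all_order all_algebra.

Set Implicit Arguments.
Unset Strict Implicit.
Unset Printing Implicit Defensive.

Import GRing.Theory.
Local Open Scope ring_scope.

Fixpoint Fseq (a b i : nat) : {poly int} :=
  match i with
  | 0 => 0
  | 1 => 1
  | (j.+1 as k).+1 => a%:R * 'X * Fseq a b k + b%:R * Fseq a b j
  end.

Definition ratfun_of_Zpoly (p : {poly int}) : {fraction {poly rat}} :=
  FracField.tofrac (map_poly (intr : int -> rat) p).

Definition in_Zpoly (r : {fraction {poly rat}}) : Prop :=
  exists p : {poly int}, r = ratfun_of_Zpoly p.

(* f(x, q(x)).  For positive a and b the denominator is never zero on Q(x):
   a root q would make the discriminant a^2 x^2 + 4 b a square in Q(x).  So the
   convention r / 0 = 0 plays no role here. *)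
Definition genfun (a b : nat) (q : {fraction {poly rat}}) : {fraction {poly rat}} :=
  q / (1 - a%:R * ratfun_of_Zpoly 'X * q - b%:R * q ^+ 2).

(* Main.v *)
Require Import Defs.
From HB Require Import structures.
From mathcomp Require Import all_boot all_order all_algebra.
From mathcomp Require Import ring zify.

Import Order.TTheory GRing.Theory Num.Theory.
Local Open Scope ring_scope.

(** Write q = n / m in lowest terms over Q[x], with A = a x and B = b.  Then
    f(x, q) = n m / E, where E = m ^ 2 - A n m - B n ^ 2 is the binary quadratic
    form [qform].  An irreducible common factor of E with n or m would divide
    both, so E is prime to n m; hence f(x, q) can be a polynomial only if E is constant.

    Constancy of E is a Pell-like equation, solved by descent on degrees.
    Equal degrees are impossible, because the term A n m dominates.  If n has
    the smaller degree, then m (m - A n) = E + B n ^ 2 forces m - A n = B n'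
    with n' of smaller degree than n, and (n', n) satisfies the same kind of
    equation ([qformS]).  The descent stops at n = 0 with m constant, so (n, m)
    is a constant multiple of two consecutive terms (F_i, F_(i+1))
    ([small_qform_consecutive]).  If n has the larger degree, the symmetry
    q -> -1 / (b q), which preserves f ([genf_swap]), exchanges the roles and
    yields the second family.

    Conversely the same step relation gives the Cassini identity: E takes the
    value (-b) ^ i at (F_i, F_(i+1)), so f(x, F_i / F_(i+1)) is
    F_i F_(i+1) / (-b) ^ i.  As b divides a, every second step of the recurrence
    gains a factor b, so F_i is divisible by b ^ (i./2), which makes the product
    F_i F_(i+1) divisible by b ^ i. *)

(** * The quadratic form attached to the recurrence *)

Definition qform {R : comNzRingType} (A B n m : R) : R :=
  m ^+ 2 - A * n * m - B * n ^+ 2.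

(** One step of the recurrence, (n', n) -> (n, A n + B n'), is a similitude of
    the form with multiplier - B; read forwards it gives Cassini's identity,
    read backwards it drives the descent. *)
Lemma qformS {R : comNzRingType} (A B n' n : R) :
  qform A B n (A * n + B * n') = - B * qform A B n' n.
Proof. by rewrite /qform; ring. Qed.

Lemma qform_swap {R : comNzRingType} (A B n m : R) :
  qform A B (- m) (B * n) = - B * qform A B n m.
Proof. by rewrite /qform; ring. Qed.

Lemma rmorph_qform {R S : comNzRingType} (f : {rmorphism R -> S}) (A B n m : R) :
  f (qform A B n m) = qform (f A) (f B) (f n) (f m).
Proof. by rewrite /qform !expr2 !rmorphB !rmorphM. Qed.

(** * The generating function as a rational map *)

Definition genf {L : fieldType} (A B q : L) : L := q / (1 - A * q - B * q ^+ 2).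

Lemma genf_frac {L : fieldType} (A B n m : L) : m != 0 ->
  genf A B (n / m) = n * m / qform A B n m.
Proof.
move=> m0; rewrite /genf.
have -> : 1 - A * (n / m) - B * (n / m) ^+ 2 = qform A B n m / m ^+ 2.
  by rewrite /qform; field.
rewrite invf_div !mulrA; congr (_ / _).
by field.
Qed.

Lemma genf_swap {L : fieldType} (A B n m : L) : B != 0 -> n != 0 -> m != 0 ->
  genf A B (- (m / (B * n))) = genf A B (n / m).
Proof.
move=> B0 n0 m0; rewrite -mulNr !genf_frac ?mulf_neq0 // qform_swap.
have -> : - m * (B * n) = - B * (n * m) by ring.
by rewrite -mulf_div divff ?mul1r // oppr_eq0.
Qed.

(** * Polynomial pairs at which the form is constant *)

Section Descent.
Context {K : fieldType}.
Implicit Types (A n m : {poly K}).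

(* Restating the lemma at K makes the sizes syntactically equal, for [lia], to
   those coming from the hypotheses. *)
Let size_mul n m : n != 0 -> m != 0 -> size (n * m) = (size n + size m).-1.
Proof. exact: size_mul. Qed.

(** The form is congruent to m ^ 2 modulo n and to - B n ^ 2 modulo m. *)
Lemma coprime_qform A (beta : K) n m : beta != 0 -> coprimep n m ->
  coprimep (qform A beta%:P n m) (n * m).
Proof.
move=> b0 cnm; rewrite coprimep_sym coprimepMl; apply/andP; split.
  have -> : qform A beta%:P n m = (- A * m - beta%:P * n) * n + m ^+ 2.
    by rewrite /qform; ring.
  by rewrite coprimep_addl_mul coprimep_expr.
have -> : qform A beta%:P n m = (m - A * n) * m + (- beta) *: n ^+ 2.
  by rewrite /qform -mul_polyC polyCN; ring.
by rewrite coprimep_addl_mul coprimepZr ?oppr_eq0 // coprimep_expr // coprimep_sym.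
Qed.

(** The cross term A n m alone has the top degree, since A is not constant. *)
Lemma size_qform_eq_size A (beta : K) n m :
  (1 < size A)%N -> m != 0 -> size n = size m ->
  (1 < size (qform A beta%:P n m))%N.
Proof.
move=> sA m0 snm.
have A0 : A != 0 by rewrite -size_poly_gt0; lia.
have n0 : n != 0 by rewrite -size_poly_gt0 snm size_poly_gt0.
have mgt0 : (0 < size m)%N by rewrite size_poly_gt0.
have sAnm : size (- (A * n * m)) = ((size A + size m).-1 + size m).-1.
  by rewrite size_polyN !size_mul ?mulf_neq0 // snm.
have sm2 : size (m ^+ 2) = (size m + size m).-1 by rewrite expr2 size_mul.
have sn2 : (size (- (beta%:P * n ^+ 2)) <= (size m + size m).-1)%N.
  rewrite size_polyN mul_polyC (leq_trans (size_scale_leq _ _)) //.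
  by rewrite expr2 size_mul // snm.
have -> : qform A beta%:P n m
    = - (A * n * m) + (m ^+ 2 + - (beta%:P * n ^+ 2)).
  by rewrite /qform; ring.
have srest : (size (m ^+ 2 + - (beta%:P * n ^+ 2))%R <= (size m + size m).-1)%N.
  by apply: leq_trans (size_polyD _ _) _; rewrite geq_max sm2 leqnn.
rewrite size_polyDl sAnm; first by lia.
by apply: leq_ltn_trans srest _; lia.
Qed.

(** Descent on the size of n: the pair (n', n) preceding (n, m) under the
    recurrence keeps the form constant, and m (beta n') = E + beta n ^ 2, with E
    the value of the form, makes n' smaller than n. *)
Lemma small_qform_consecutive A (beta : K) (u : nat -> {poly K}) :
    beta != 0 -> u 0%N = 0 -> u 1%N = 1 ->
    (forall i, u i.+2 = A * u i.+1 + beta%:P * u i) ->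
  forall n m, (size n < size m)%N -> (size (qform A beta%:P n m) <= 1)%N ->
  exists i k, n = k *: u i /\ m = k *: u i.+1.
Proof.
move=> b0 u0 u1 urec n; have [N] := ubnP (size n).
elim: N n => // N IHN n sN m snm sE.
have m0 : m != 0 by rewrite -size_poly_gt0; lia.
have [n0|n0] := eqVneq n 0.
  exists 0%N, (lead_coef m); rewrite u0 u1 n0 scaler0; split=> //.
  move: sE; rewrite n0 /qform mulr0 mul0r expr0n mulr0 !subr0 expr2 size_mul //.
  move=> sm; have /size_poly1P[c _ ->] : size m == 1%N.
    by move: m0; rewrite -size_poly_gt0; lia.
  by rewrite lead_coefC alg_polyC.
(* the unique n' for which (n', n) is followed by m in the recurrence *)
pose n' := beta^-1 *: (m - A * n).
have mE : m = A * n + beta%:P * n'.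
  by rewrite mul_polyC scalerA divff // scale1r; ring.
have sn' : (size n' < size n)%N.
  suff: (size (m - A * n)%R < size n)%N by rewrite size_scale ?invr_eq0.
  have [->|r0] := eqVneq (m - A * n) 0; first by rewrite size_poly0 size_poly_gt0.
  have : (size (m * (m - A * n))%R <= (size n + size n).-1)%N.
    have -> : m * (m - A * n) = qform A beta%:P n m + beta%:P * n ^+ 2.
      by rewrite /qform; ring.
    apply: leq_trans (size_polyD _ _) _.
    rewrite geq_max; apply/andP; split.
      by apply: leq_trans sE _; move: n0; rewrite -size_poly_gt0; lia.
    by rewrite mul_polyC size_scale // expr2 size_mul.
  by rewrite size_mul //; move: n0 r0 m0; rewrite -!size_poly_gt0; lia.
have sE' : (size (qform A beta%:P n' n) <= 1)%N.
  move: sE; rewrite mE qformS -polyCN mul_polyC size_scale //.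
  by rewrite oppr_eq0.
have [|i [k [n'E nE]]] := IHN n' _ n sn' sE'; first exact: leq_trans sn' sN.
exists i.+1, k; split=> //.
by rewrite mE n'E nE urec scalerDr !scalerAr.
Qed.

End Descent.

(** * Rational functions with polynomial image *)

Local Notation tofrac := (@FracField.tofrac _).

Lemma fracE {R : idomainType} (q : {fraction R}) :
  q = tofrac \n_(repr q) / tofrac \d_(repr q).
Proof.
have d0 := denom_ratioP (repr q).
rewrite -[LHS]reprK; unlock FracField.tofrac.
rewrite -[X in _ * X]FracField.pi_inv -[RHS]FracField.pi_mul.
rewrite /FracField.mulf /FracField.invf !numden_Ratio ?oner_neq0 //.
by rewrite mulr1 mul1r Ratio_numden.
Qed.

Lemma coprime_frac {K : fieldType} (q : {fraction {poly K}}) :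
  exists n m : {poly K}, [/\ m != 0, coprimep n m &
    q = tofrac n / tofrac m].
Proof.
pose r := repr q; pose g := gcdp \n_r \d_r.
have d0 : \d_r != 0 by apply: denom_ratioP.
have g0 : g != 0 by rewrite gcdp_eq0 (negPf d0) andbF.
have nE : \n_r %/ g * g = \n_r by rewrite divpK // dvdp_gcdl.
have dE : \d_r %/ g * g = \d_r by rewrite divpK // dvdp_gcdr.
exists (\n_r %/ g), (\d_r %/ g); split.
- by apply: contraNneq d0 => e; rewrite -dE e mul0r.
- by apply: coprimep_div_gcd; rewrite d0 orbT.
- by rewrite {1}[q]fracE -[in LHS]nE -[in LHS]dE !rmorphM /= -mulf_div divff ?mulr1 //
    tofrac_eq0.
Qed.

Lemma tofrac_scale_div {K : fieldType} (k : K) (p r : {poly K}) : k != 0 ->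
  tofrac (k *: p) / tofrac (k *: r) = tofrac p / tofrac r.
Proof.
by move=> k0; rewrite -!mul_polyC !rmorphM -mulf_div divff ?mul1r // tofrac_eq0
  polyC_eq0.
Qed.

(** In lowest terms the value n m / E can be a polynomial only for constant E;
    the comparison of the degrees of n and m then decides between the two
    families, the second one coming from the descent applied to the swapped
    pair (- m, beta n). *)
Lemma genf_polynomial {K : fieldType} (A : {poly K}) (beta : K)
    (u : nat -> {poly K}) (q : {fraction {poly K}}) (p : {poly K}) :
    (1 < size A)%N -> beta != 0 -> u 0%N = 0 -> u 1%N = 1 ->
    (forall i, u i.+2 = A * u i.+1 + beta%:P * u i) ->
    genf (tofrac A) (tofrac beta%:P) q = tofrac p ->
  (exists i, q = tofrac (u i) / tofrac (u i.+1)) \/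
  (exists i, (0 < i)%N /\
     q = - (tofrac (u i.+1) / (tofrac beta%:P * tofrac (u i)))).
Proof.
move=> sA b0 u0 u1 urec.
have [n [m [m0 cnm ->]]] := coprime_frac q.
rewrite genf_frac ?tofrac_eq0 // -rmorph_qform /=.
set E := qform _ _ _ _ => pE.
have sE : (size E <= 1)%N.
  have [->|E0] := eqVneq E 0; first by rewrite size_poly0.
  (* E divides n m and is prime to it, so it divides 1 *)
  have nmE : n * m = p * E.
    apply/eqP; rewrite -tofrac_eq !tofracM -pE divfK //.
    by rewrite tofrac_eq0.
  have /coprimepP/(_ E (dvdpp E)) := coprime_qform A beta n m b0 cnm.
  rewrite nmE dvdp_mull // => /(_ isT).
  by rewrite -size_poly_eq1 => /eqP ->.
have [snm|smn|snm] := ltngtP (size n) (size m).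
- have [i [k [nE mE]]] := small_qform_consecutive A beta u b0 u0 u1 urec n m snm sE.
  left; exists i; rewrite nE mE tofrac_scale_div //.
  by apply: contraNneq m0 => k0; rewrite mE k0 scale0r.
- have n0 : n != 0 by rewrite -size_poly_gt0; apply: leq_ltn_trans smn.
  have [||i [k [mE nE]]] :=
      small_qform_consecutive A beta u b0 u0 u1 urec (- m) (beta%:P * n).
  + by rewrite size_polyN mul_polyC size_scale.
  + by rewrite qform_swap -polyCN mul_polyC size_scale ?oppr_eq0.
  have k0 : k != 0.
    by apply: contraNneq m0 => k0; rewrite -oppr_eq0 mE k0 scale0r.
  right; exists i; split.
    case: i mE {nE} => // mE.
    by move: m0; rewrite -oppr_eq0 mE u0 scaler0 eqxx.
  have B0 : tofrac beta%:P != 0 by rewrite tofrac_eq0 polyC_eq0.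
  have -> : tofrac n / tofrac m
      = - (tofrac (beta%:P * n) / (tofrac beta%:P * tofrac (- m))).
    by rewrite rmorphM rmorphN -mulf_div divff // mul1r invrN mulrN opprK.
  by rewrite mE nE -!rmorphM -scalerAr tofrac_scale_div.
- have := size_qform_eq_size A beta n m sA m0 snm.
  by rewrite ltnNge sE.
Qed.

(** * The integral sequence *)

Lemma FseqS a b i :
  Fseq a b i.+2 = a%:R * 'X * Fseq a b i.+1 + b%:R * Fseq a b i.
Proof. by []. Qed.

Lemma Fseq_Cassini a b i :
  qform (a%:R * 'X) b%:R (Fseq a b i) (Fseq a b i.+1) = (- b%:R) ^+ i.
Proof.
elim: i => [|i IHi]; first by rewrite /qform /=; ring.
by rewrite FseqS qformS IHi exprS.
Qed.

Lemma FseqS_neq0 a b i : (0 < a)%N -> Fseq a b i.+1 != 0.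
Proof.
move=> a0.
(* all coefficients are nonnegative, so the value at 1 detects nonvanishing *)
suff /andP[_ pos] : (0 <= (Fseq a b i).[1]) && (0 < (Fseq a b i.+1).[1]).
  by apply: contraTneq pos => ->; rewrite horner0 ltxx.
elim: i => [|i /andP[ge0 gt0]]; first by rewrite /= !hornerE.
rewrite ltW // FseqS hornerD !hornerM hornerX mulr1 -!polyC_natr !hornerC.
by rewrite ltr_wpDr ?mulr_ge0 ?mulr_gt0 ?ler0n ?ltr0n.
Qed.

(** Since b divides a, both terms of the recurrence for F_(i+2) contain one more
    factor b than is known for F_i. *)
Lemma Fseq_dvd a b i : (b %| a)%N -> exists g, Fseq a b i = b%:R ^+ i./2 * g.
Proof.
move=> /dvdnP[c ->].
suff: (exists g, Fseq (c * b) b i = b%:R ^+ i./2 * g) /\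
      (exists g, Fseq (c * b) b i.+1 = b%:R ^+ i.+1./2 * g) by case.
elim: i => [|i [[g gE] [h hE]]].
  by split; [exists 0; rewrite mulr0 | exists 1; rewrite mulr1].
split; first by exists h.
(* i.+1./2 exceeds i./2 exactly when i is odd, whence the power of b *)
exists (c%:R * 'X * (b%:R ^+ odd i) * h + g).
by rewrite FseqS gE hE /= natrM exprS uphalf_half exprD; ring.
Qed.

(** * Integrality of the values *)

(* lets the generic ring morphism lemmas apply to the embedding of Z[x] *)
HB.instance Definition _ := GRing.RMorphism.copy ratfun_of_Zpoly
  (@FracField.tofrac {poly rat} \o map_poly (intr : int -> rat)).

Lemma ratfun_of_Zpoly_eq0 p : (ratfun_of_Zpoly p == 0) = (p == 0).
Proof.
rewrite /ratfun_of_Zpoly tofrac_eq0 -(rmorph0 (map_poly intr)).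
by rewrite (inj_eq (map_inj_poly intr_inj _)).
Qed.

Lemma genfunE a b q :
  genfun a b q = genf (ratfun_of_Zpoly (a%:R * 'X)) (ratfun_of_Zpoly b%:R) q.
Proof. by rewrite /genfun /genf rmorphM !rmorph_nat. Qed.

(** The exponents of b available in the two factors, i./2 and i.+1./2, add up to
    i, the exponent in Cassini's identity. *)
Lemma genfun_Fseq_in_Zpoly a b i : (0 < a)%N -> (0 < b)%N -> (b %| a)%N ->
  in_Zpoly (genfun a b
    (ratfun_of_Zpoly (Fseq a b i) / ratfun_of_Zpoly (Fseq a b i.+1))).
Proof.
move=> a0 b0 ba.
have [g gE] := Fseq_dvd a b i ba; have [h hE] := Fseq_dvd a b i.+1 ba.
have FF : Fseq a b i * Fseq a b i.+1 = g * h * (- 1) ^+ i * (- b%:R) ^+ i.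
  rewrite -mulrA -exprMn mulN1r opprK -{3}[i]odd_double_half gE hE.
  rewrite -uphalfE uphalf_half -addnn !exprD; ring.
exists (g * h * (- 1) ^+ i).
rewrite genfunE genf_frac ?ratfun_of_Zpoly_eq0 ?FseqS_neq0 //.
rewrite -rmorph_qform Fseq_Cassini /= -rmorphM FF rmorphM mulfK //.
by rewrite ratfun_of_Zpoly_eq0 expf_neq0 // oppr_eq0 -polyC_natr polyC_eq0
  pnatr_eq0 -lt0n.
Qed.

Theorem theorem1p2 (a b : nat) (ha : (0 < a)%N) (hb : (0 < b)%N)
    (hba : (b %| a)%N) (q : {fraction {poly rat}}) :
  in_Zpoly (genfun a b q) <->
  (exists i : nat,
     q = ratfun_of_Zpoly (Fseq a b i) / ratfun_of_Zpoly (Fseq a b i.+1)) \/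
  (exists i : nat, (0 < i)%N /\
     q = - (ratfun_of_Zpoly (Fseq a b i.+1)
              / (b%:R * ratfun_of_Zpoly (Fseq a b i)))).
Proof.
split=> [[p]|[[i ->]|[[|i] [// _ ->]]]].
- pose F i : {poly rat} := map_poly intr (Fseq a b i).
  have EA : map_poly intr (a%:R * 'X) = a%:R * 'X :> {poly rat}.
    by rewrite rmorphM rmorph_nat /= map_polyX.
  have Eb : map_poly intr b%:R = (b%:R)%:P :> {poly rat}.
    by rewrite rmorph_nat polyC_natr.
  have sA : (1 < size (a%:R * 'X : {poly rat})%R)%N.
    by rewrite -polyC_natr mul_polyC size_scale ?size_polyX // pnatr_eq0 -lt0n.
  have b0 : b%:R != 0 :> rat by rewrite pnatr_eq0 -lt0n.
  have F0 : F 0%N = 0 by rewrite /F rmorph0.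
  have F1 : F 1%N = 1 by rewrite /F rmorph1.
  have FS i : F i.+2 = a%:R * 'X * F i.+1 + (b%:R)%:P * F i.
    by rewrite /F FseqS rmorphD (rmorphM _ (a%:R * 'X)) (rmorphM _ b%:R) /= EA Eb.
  rewrite genfunE /ratfun_of_Zpoly EA Eb.
  move=> /(genf_polynomial _ _ F _ _ sA b0 F0 F1 FS).
  by rewrite polyC_natr rmorph_nat.
- exact: genfun_Fseq_in_Zpoly.
have F0 j : ratfun_of_Zpoly (Fseq a b j.+1) != 0.
  by rewrite ratfun_of_Zpoly_eq0 FseqS_neq0.
rewrite genfunE -(rmorph_nat ratfun_of_Zpoly) genf_swap ?F0 //.
  by rewrite -genfunE; apply: genfun_Fseq_in_Zpoly.
by rewrite ratfun_of_Zpoly_eq0 -polyC_natr polyC_eq0 pnatr_eq0 -lt0n.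
Qed.
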